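(* Let $G$ be a Ramanujan graph of degree $d\ge 3$ on $N$ vertices with non-negative resistance curvature. Then the maximum effective resistance $R_{\max}=\max_{u,v\in V}R_{\mathrm{eff}}(u,v)$ satisfies $$R_{\max}\;\le\;\frac{2}{d-2\sqrt{d-1}}.$$
   Context: Graphs are finite, simple, undirected and unweighted, with vertex set $V$. $R_{\mathrm{eff}}(u,v)$ is the effective resistance between $u$ and $v$ when every edge is a unit resistor. A Ramanujan graph of degree $d$ is a finite connected $d$-regular graph such that every eigenvalue $\mu$ of its adjacency matrix other than the trivial (simple) eigenvalue $d$ satisfies $|\mu|\le 2\sqrt{d-1}$. For a vertex $v$ with neighbor set $\mathcal N(v)$, the resistance curvature is $$p(v)=1-\frac12\sum_{u\in\mathcal N(v)}R_{\mathrm{eff}}(v,u),$$ and $G$ has non-negative resistance curvature (is ''RN'') if $p(v)\ge 0$ for every vertex $v$. *)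

(* Defs.v *)
From mathcomp Require Import all_boot all_order all_algebra.
Set Implicit Arguments.
Unset Strict Implicit.
Unset Printing Implicit Defensive.
Import Order.TTheory GRing.Theory Num.Theory.
Local Open Scope ring_scope.

Record sgraph := SGraph {
  vertex :> finType;
  adj : rel vertex;
  adj_sym : symmetric adj;
  adj_irr : irreflexive adj }.

Definition neighbors (G : sgraph) (v : G) : {set G} := [set u | adj v u].

Definition regular (G : sgraph) (d : nat) : Prop :=
  forall v : G, #|neighbors v| = d.

Definition connected_graph (G : sgraph) : Prop :=
  (0 < #|G|)%N /\ forall u v : G, connect (@adj G) u v.

(* Rows and columns of the matrices below are indexed by the position of the
   vertices in enum G. *)
Definition adjacency_mx (R : nzRingType) (G : sgraph) : 'M[R]_#|G| :=
  \matrix_(i, j) (adj (enum_val i) (enum_val j))%:R.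

Definition degree_mx (R : nzRingType) (G : sgraph) : 'M[R]_#|G| :=
  diag_mx (\row_i #|neighbors (enum_val i)|%:R).

Definition laplacian_mx (R : nzRingType) (G : sgraph) : 'M[R]_#|G| :=
  degree_mx R G - adjacency_mx R G.

(* One unit of current injected at u and extracted at v. *)
Definition unit_flow (R : nzRingType) (G : sgraph) (u v : G) : 'rV[R]_#|G| :=
  delta_mx 0 (enum_rank u) - delta_mx 0 (enum_rank v).

(* With b = unit_flow u v, the row vector phi = b *m pinvmx L is a potential
   solving Kirchhoff's and Ohm's laws phi *m L = b for unit conductances
   (lemma unit_flow_potential, for connected G), and the effective resistance
   is the potential drop phi u - phi v = phi *m b^T.  The drop does not depend
   on the solution phi (lemma reffE).  The value is only meaningful when u and
   v are in the same connected component. *)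
Definition reff (R : fieldType) (G : sgraph) (u v : G) : R :=
  (unit_flow R u v *m pinvmx (laplacian_mx R G) *m (unit_flow R u v)^T) 0 0.

(* The seed 0 is itself one of the values, reff u u, as soon as G is
   nonempty. *)
Definition reff_max (R : realFieldType) (G : sgraph) : R :=
  \big[Num.max/0]_(p : G * G) reff R p.1 p.2.

Definition resistance_curvature (R : fieldType) (G : sgraph) (v : G) : R :=
  1 - 2^-1 * \sum_(u in neighbors v) reff R v u.

Definition nonneg_resistance_curvature (R : realFieldType) (G : sgraph) : Prop :=
  forall v : G, 0 <= resistance_curvature R v.

(* The adjacency matrix is symmetric, so over a real closed field all its
   eigenvalues lie in R.  The eigenvalue d is simple since G is connected. *)
Definition ramanujan (R : rcfType) (G : sgraph) (d : nat) : Prop :=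
  [/\ connected_graph G, regular G d &
      forall mu : R, eigenvalue (adjacency_mx R G) mu -> mu != d%:R ->
        `|mu| <= 2 * Num.sqrt (d%:R - 1)].

Lemma reff_self (R : fieldType) (G : sgraph) (u : G) : reff R u u = 0.
Proof. by rewrite /reff /unit_flow subrr trmx0 mulmx0 mxE. Qed.

Lemma laplacian_mx_sym (R : nzRingType) (G : sgraph) :
  (laplacian_mx R G)^T = laplacian_mx R G.
Proof.
rewrite /laplacian_mx linearB /= tr_diag_mx; congr (_ - _).
by apply/matrixP=> i j; rewrite !mxE adj_sym.
Qed.

Lemma reffE (R : fieldType) (G : sgraph) (u v : G) (phi : 'rV[R]_#|G|) :
  phi *m laplacian_mx R G = unit_flow R u v ->
  reff R u v = phi 0 (enum_rank u) - phi 0 (enum_rank v).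
Proof.
move=> phiL; set L := laplacian_mx R G in phiL *.
set b := unit_flow R u v in phiL *.
have bL : (b <= L)%MS by rewrite -phiL submxMl.
have bT : b^T = L *m phi^T by rewrite -phiL trmx_mul laplacian_mx_sym.
have -> : reff R u v = (phi *m b^T) 0 0.
  rewrite /reff -[unit_flow R u v]/b -[laplacian_mx R G]/L bT mulmxA.
  by rewrite mulmxKpV // -phiL -mulmxA.
rewrite /b /unit_flow linearB /= mulmxBr !trmx_delta -!colE.
by rewrite !mxE.
Qed.

Lemma mul_laplacian_col (R : nzRingType) (G : sgraph) (c : 'cV[R]_#|G|) i :
  (laplacian_mx R G *m c) i 0 =
  \sum_j (adj (enum_val i) (enum_val j))%:R * (c i 0 - c j 0).
Proof.
rewrite mulmxBl mxE [in X in _ + X]mxE mul_diag_mx !mxE.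
under [RHS]eq_bigr do rewrite mulrBr.
rewrite sumrB; congr (_ - _); last by apply: eq_bigr => j _; rewrite !mxE.
rewrite -mulr_suml; congr (_ * _).
rewrite -sum1_card natr_sum big_mkcond (reindex _ (onW_bij _ (@enum_val_bij G))).
by apply: eq_bigr => j _ /=; rewrite inE; case: adj.
Qed.

Lemma laplacian_ker_const (R : realFieldType) (G : sgraph) (c : 'cV[R]_#|G|) :
  connected_graph G -> laplacian_mx R G *m c = 0 -> forall i j, c i 0 = c j 0.
Proof.
move=> [_ conn] Lc0 i j.
pose A (k l : 'I_#|G|) : R := (adj (enum_val k) (enum_val l))%:R.
have Asym k l : A k l = A l k by rewrite /A adj_sym.
pose S := \sum_k \sum_l A k l * (c k 0 - c l 0) ^+ 2.
have H0 : \sum_k c k 0 * \sum_l A k l * (c k 0 - c l 0) = 0.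
  by apply: big1 => k _; rewrite -mul_laplacian_col Lc0 mxE mulr0.
have S0 : S = 0.
  have -> : S = \sum_k c k 0 * \sum_l A k l * (c k 0 - c l 0) +
                \sum_k c k 0 * \sum_l A k l * (c k 0 - c l 0).
    rewrite /S; under [X in X + _]eq_bigr do rewrite mulr_sumr.
    under [X in _ + X]eq_bigr do rewrite mulr_sumr.
    rewrite [X in _ + X]exchange_big -big_split; apply: eq_bigr => k _.
    rewrite -big_split; apply: eq_bigr => l _ /=.
    rewrite (Asym l k) expr2 ![c _ 0 * (A k l * _)]mulrCA -mulrDr; congr (_ * _).
    by rewrite -[c l 0 - c k 0]opprB mulrN -mulrBl.
  by rewrite H0 addr0.
have pos k l : 0 <= A k l * (c k 0 - c l 0) ^+ 2.
  by rewrite mulr_ge0 ?ler0n ?sqr_ge0.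
have adjE x y : adj x y -> c (enum_rank x) 0 = c (enum_rank y) 0.
  move=> xy; have := S0; rewrite /S => /psumr_eq0P h1.
  have /psumr_eq0P h2 := h1 (fun k _ => sumr_ge0 _ (fun l _ => pos k l))
    (enum_rank x) isT.
  have := h2 (fun l _ => pos _ l) (enum_rank y) isT.
  rewrite /A !enum_rankK xy mul1r => /eqP.
  by rewrite sqrf_eq0 subr_eq0 => /eqP.
suff connE x y : c (enum_rank x) 0 = c (enum_rank y) 0.
  by rewrite -(enum_valK i) -(enum_valK j); apply: connE.
have /connectP[p + ->] := conn x y.
by elim: p x => //= z p IH x /andP[/adjE -> /IH].
Qed.

Lemma unit_flow_potential (R : realFieldType) (G : sgraph) (u v : G) :
  connected_graph G ->
  unit_flow R u v *m pinvmx (laplacian_mx R G) *m laplacian_mx R G =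
  unit_flow R u v.
Proof.
move=> conn; apply: mulmxKpV; rewrite submxE; apply/eqP/matrixP=> i k.
set C := cokermx _; rewrite ord1 mulmxBl -!rowE !mxE.
have Lc : laplacian_mx R G *m col k C = 0.
  by rewrite colE mulmxA mulmx_coker mul0mx.
have := laplacian_ker_const conn Lc (enum_rank u) (enum_rank v).
by rewrite !mxE => ->; rewrite subrr.
Qed.

(* Main.v *)
(* Put a = d and b = 2 sqrt (d - 1), and let phi be the potential of a unit
   flow f from u to v, so that phi (A - a) = - f.  Every adjacency eigenvalue mu
   is equal to a or at most b < a, so (mu - a) (mu - b) >= 0 and the matrix
   (A - a) (A - b) is positive semidefinite.  Evaluating its form at phi gives
   0 <= f f^T - (a - b) phi f^T = |f|^2 - (a - b) R_eff(u, v), and |f|^2 <= 2. *)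
Require Import Defs.
From mathcomp Require Import all_boot all_order all_algebra.
From mathcomp Require Import ring lra complex.
Import Order.TTheory GRing.Theory Num.Theory.
Local Open Scope ring_scope.

(** Over [R[i]] the matrix is Hermitian, hence unitarily diagonalizable with a real spectrum. In
    eigenbasis coordinates [y] the form is the sum of [|y_i|^2 (r_i - a) (r_i - b)] over the
    eigenvalues [r_i]. *)
Lemma symmetric_quadratic_ge0 (R : rcfType) (n : nat) (A : 'M[R]_n) (a b : R)
    (x : 'rV[R]_n) :
  A^T = A ->
  (forall mu, eigenvalue A mu -> 0 <= (mu - a) * (mu - b)) ->
  0 <= (x *m (A - a%:M) *m (A - b%:M) *m x^T) 0 0.
Proof.
move=> Asym eigA; set toC := real_complex R.
pose Ac : 'M[R[i]%C]_n := map_mx toC A; pose xc := map_mx toC x.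
have conjC_toC (r : R) : (toC r)^* = toC r.
  by apply/CrealP; rewrite complex_real.
have Aherm : Ac \is hermsymmx.
  apply: realsym_hermsym.
    apply/is_hermitianmxP; rewrite expr0 scale1r map_mx_id //.
    by rewrite /Ac map_trmx Asym.
  by apply/mxOverP => i j; rewrite mxE complex_real.
have /orthomx_spectralP := hermitian_normalmx Aherm.
have := hermitian_spectral_diag_real Aherm.
have := spectral_unitarymx Ac.
move: (spectralmx Ac) (spectral_diag Ac) => P D Pu /mxOverP Dreal AE.
have Punit := unitarymx_unit Pu.
(* Row [i] of [P] is an eigenvector for [D 0 i], nonzero because [P] is invertible; a real
   eigenvalue of [Ac] is one of [A]. *)
have DE i : exists2 r : R, D 0 i = toC r & 0 <= (r - a) * (r - b).
  have /complex_realP[r Dr] := Dreal 0 i; exists r => //; apply: eigA.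
  rewrite -(eigenvalue_map toC) -/Ac; apply/eigenvalueP.
  exists (delta_mx 0 i *m P).
    by rewrite AE !mulmxA mulmxK // -[_ *m diag_mx D]rowE row_diag_mx Dr -scalemxAl.
  apply: contraTneq isT => /(congr1 (mulmx^~ (invmx P))) /=.
  rewrite mulmxK // mul0mx => /matrixP/(_ 0 i) /eqP.
  by rewrite !mxE !eqxx oner_eq0.
have shiftE c : map_mx toC (A - c%:M) =
    invmx P *m diag_mx (D - const_mx (toC c)) *m P.
  rewrite map_mxB map_scalar_mx linearB /= diag_const_mx mulmxBr mulmxBl -AE.
  by rewrite mul_mx_scalar -scalemxAl mulVmx // scalemx1.
rewrite -ler0c; pose y := xc *m invmx P.
(* As [P] is unitary and [x] real, the right end of the form is the conjugate of the left end, which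
   yields the squared moduli. *)
have yE : P *m map_mx toC x^T = (map_mx Num.conj y)^T.
  have xcJ : map_mx Num.conj xc = xc.
    by apply/matrixP => i j; rewrite !mxE conjC_toC.
  rewrite /y invmx_unitary // map_mxM xcJ -map_mx_comp trmx_mul.
  by rewrite (map_mx_id (@conjCK _)) trmxK map_trmx.
suff -> : ((x *m (A - a%:M) *m (A - b%:M) *m x^T) 0 0)%:C%C =
    \sum_i `|y 0 i| ^+ 2 * ((D 0 i - toC a) * (D 0 i - toC b)).
  apply: sumr_ge0 => i _; have [r -> pos_r] := DE i.
  by rewrite -!rmorphB -rmorphM mulr_ge0 ?exprn_ge0 // ler0c.
transitivity (map_mx toC (x *m (A - a%:M) *m (A - b%:M) *m x^T) 0 0).
  by rewrite [RHS]mxE.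
rewrite !map_mxM !shiftE !mulmxA mulmxK // -mulmxA yE -/xc -/y.
rewrite !mul_mx_diag !mxE; apply: eq_bigr => i _; rewrite !mxE normCK.
by ring.
Qed.

Lemma unit_flow_normsq_le2 (R : numDomainType) (G : sgraph) (u v : G) :
  (unit_flow R u v *m (unit_flow R u v)^T) 0 0 <= 2.
Proof.
rewrite /unit_flow linearB /= mulmxBr !trmx_delta -!colE !mxE !eqxx /=.
rewrite [enum_rank v == enum_rank u]eq_sym.
by case: eqP => _ /=; rewrite ?subrr ?subr0 ?sub0r ?opprK // ler0n.
Qed.

Lemma reff_le_spectral_gap (R : rcfType) (G : sgraph) (d : nat) (mu0 : R)
    (u v : G) :
  connected_graph G -> regular G d -> mu0 < d%:R ->
  (forall mu, eigenvalue (adjacency_mx R G) mu -> mu != d%:R -> mu <= mu0) ->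
  reff R u v <= 2 / (d%:R - mu0).
Proof.
move=> conn reg mu0_lt eig_le; set f := unit_flow R u v.
set phi := f *m pinvmx (laplacian_mx R G).
have LE : laplacian_mx R G = (d%:R)%:M - adjacency_mx R G.
  rewrite /laplacian_mx /degree_mx -diag_const_mx; congr (diag_mx _ - _).
  by apply/rowP => i; rewrite !mxE reg.
have phiA : phi *m (adjacency_mx R G - (d%:R)%:M) = - f.
  by rewrite -opprB -LE mulmxN unit_flow_potential.
have Asym : (adjacency_mx R G)^T = adjacency_mx R G.
  by apply/matrixP => i j; rewrite !mxE adj_sym.
have := @symmetric_quadratic_ge0 R _ _ d%:R mu0 phi Asym.
(* Writing [A - mu0] as [(A - d) + (d - mu0)] lets [phiA] act on the second factor too. *)
have AphiT : (adjacency_mx R G - mu0%:M) *m phi^T =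
    (d%:R - mu0) *: phi^T - f^T.
  have -> : adjacency_mx R G - mu0%:M =
      (adjacency_mx R G - (d%:R)%:M) + (d%:R - mu0)%:M.
    by rewrite raddfB /= addrA subrK.
  rewrite mulmxDl mul_scalar_mx addrC; congr (_ + _).
  by rewrite -linearN -phiA [RHS]trmx_mul [(_ - _%:M)^T]linearB /= Asym tr_scalar_mx.
rewrite phiA -mulmxA AphiT mulNmx mulmxBr -scalemxAr opprB => pos.
have /pos : forall mu, eigenvalue (adjacency_mx R G) mu ->
    0 <= (mu - d%:R) * (mu - mu0).
  move=> mu /eig_le; have [->|_ /(_ isT) mu_le] := eqVneq mu d%:R.
    by rewrite subrr mul0r.
  (* Here [mu <= mu0 < d], so both factors are nonpositive. *)
  by rewrite -mulrNN mulr_ge0 // oppr_ge0 subr_le0 // (le_trans mu_le) // ltW.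
have -> : f *m phi^T = (phi *m f^T)^T by rewrite [RHS]trmx_mul trmxK.
rewrite ler_pdivlMr ?subr_gt0 //.
have := @unit_flow_normsq_le2 R G u v; rewrite -/f /reff -/f -/phi.
move: (f *m f^T) (phi *m f^T) => F M; rewrite !mxE; lra.
Qed.

Theorem corollary2 (R : rcfType) (G : sgraph) (N d : nat)
    (hN : #|G| = N) (hd : (3 <= d)%N)
    (hG : ramanujan R G d)
    (hRN : nonneg_resistance_curvature R G) :
  reff_max R G <= 2 / (d%:R - 2 * Num.sqrt (d%:R - 1)).
Proof.
have [conn reg eig] := hG.
have d_ge3 : 3 <= d%:R :> R by rewrite ler_nat.
(* With [s = sqrt (d - 1)], [d - 2 s = (s - 1)^2], and [s > 1] since [s^2 >= 2]. *)
have gap : 2 * Num.sqrt (d%:R - 1) < d%:R :> R.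
  have s_ge0 := sqrtr_ge0 (d%:R - 1 : R).
  have s_sqr : Num.sqrt (d%:R - 1) ^+ 2 = d%:R - 1 :> R by rewrite sqr_sqrtr; lra.
  nra.
(* The first goal bounds the seed 0 of the maximum. *)
apply: bigmax_le => [|[u v] _ /=].
  by rewrite divr_ge0 // subr_ge0 ltW.
apply: reff_le_spectral_gap => // mu /eig/[apply]; exact/le_trans/ler_norm.
Qed.
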